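(* Let $\{c_n\}_{n\ge1}$ be a real sequence and $\{d_{n+1}\}_{n\ge1}$ a positive chain sequence having multiple parameter sequences, and let $P_0(x)=1$, $P_1(x)=x-c_1$, $P_{n+1}(x)=(x-c_{n+1})P_n(x)-d_{n+1}(x^2+1)P_{n-1}(x)$ for $n\ge1$. Let $\{M_{n+1}\}_{n\ge0}$ be the maximal parameter sequence of $\{d_{n+1}\}_{n\ge1}$, let $\tau_0=1$ and $\tau_n=\tau_{n-1}(1-ic_n)/(1+ic_n)$ for $n\ge1$, and let $\nu$ be the probability measure on the unit circle $\mathbb T$ whose Verblunsky coefficients are \[ \beta_{n-1}=\frac{1}{\tau_{n-1}}\,\frac{1-2M_n-ic_n}{1-ic_n},\qquad n\ge1 . \] Let $\varphi$ be the measure on $\mathbb R$ defined by $d\varphi(x)=-d\nu\big((x+i)/(x-i)\big)$, i.e. the image of $\nu$ under $\zeta\mapsto i(\zeta+1)/(\zeta-1)$, so that $\int_{\mathbb R}f\,d\varphi=\int_{\mathbb T\setminus\{1\}}f\big(i(\zeta+1)/(\zeta-1)\big)\,d\nu(\zeta)$. Then for every $n\ge0$, \[ \int_{-\infty}^{\infty}x^j\,\frac{P_n(x)}{(x^2+1)^n}\,d\varphi(x)=\gamma_n\,\delta_{n,j},\qquad j=0,1,\dots,n, \] where $\gamma_0=\int_{-\infty}^\infty d\varphi(x)=\int_{\mathbb T}d\nu(\zeta)=1$ and $\gamma_n=(1-M_n)\gamma_{n-1}$ for $n\ge1$.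
   Context: A sequence $\{d_{n+1}\}_{n\ge1}$ is a positive chain sequence if there is a parameter sequence $\{g_{n+1}\}_{n\ge0}$ with $0\le g_1<1$, $0<g_n<1$ for $n\ge2$, and $d_{n+1}=(1-g_n)g_{n+1}$ for $n\ge1$. The minimal parameter sequence $\{\ell_{n+1}\}_{n\ge0}$ is the one with $\ell_1=0$. The chain sequence has multiple parameter sequences if it has more than one parameter sequence; in that case the maximal parameter sequence $\{M_{n+1}\}_{n\ge0}$ is the parameter sequence with $g_n\le M_n$ for every parameter sequence $\{g_{n+1}\}$ and all $n$. For a nontrivial probability measure on $\mathbb T$ with monic orthogonal polynomials $\Phi_n$, the Verblunsky coefficients are $\alpha_n=-\overline{\Phi_{n+1}(0)}$, $n\ge0$. *)

(* Defs.v *)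
(* mathcomp-analysis (measure/integration) + real-closed complex. *)
From mathcomp Require Import all_boot all_order all_algebra.
From mathcomp Require Import complex.
From mathcomp Require Import all_classical all_reals all_analysis.
Set Implicit Arguments. Unset Strict Implicit. Unset Printing Implicit Defensive.
Import Order.TTheory GRing.Theory Num.Theory.
Local Open Scope classical_set_scope.
Local Open Scope ring_scope.

Section Defs.
Variable R : realType.

(** Parameter sequences of a chain sequence.  Index conventions:
    [d (n.+1)] for [n >= 1] is d_{n+1}; [g n] for [n >= 1] is g_n
    (the values [d 0], [d 1], [g 0] are irrelevant). *)
Definition is_param_seq (d g : nat -> R) : Prop :=
  [/\ 0 <= g 1%N < 1,
      (forall n, (2 <= n)%N -> 0 < g n < 1) &
      (forall n, (1 <= n)%N -> d n.+1 = (1 - g n) * g n.+1)].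

Definition positive_chain_seq (d : nat -> R) : Prop :=
  exists g, is_param_seq d g.

Definition has_multiple_param_seqs (d : nat -> R) : Prop :=
  exists g1 g2, [/\ is_param_seq d g1, is_param_seq d g2 &
                    exists2 n, (1 <= n)%N & g1 n <> g2 n].

Definition is_maximal_param_seq (d M : nat -> R) : Prop :=
  is_param_seq d M /\
  forall g, is_param_seq d g -> forall n, (1 <= n)%N -> g n <= M n.

(** The polynomials P_n of the three-term recurrence (pairs (P_n, P_{n+1})). *)
Fixpoint Ppair (c d : nat -> R) (n : nat) : {poly R} * {poly R} :=
  match n with
  | 0 => (1, 'X - (c 1%N)%:P)
  | m.+1 => let (p, q) := Ppair c d m in
            (q, ('X - (c m.+2)%:P) * q - d m.+2 *: ('X ^+ 2 + 1) * p)
  end.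
Definition Ppoly (c d : nat -> R) (n : nat) : {poly R} := (Ppair c d n).1.

(** tau_0 = 1, tau_n = tau_{n-1} (1 - i c_n)/(1 + i c_n). *)
Fixpoint tau (c : nat -> R) (n : nat) : R[i] :=
  match n with
  | 0 => 1
  | m.+1 => tau c m * (Complex 1 (- c m.+1)) / (Complex 1 (c m.+1))
  end.

(** beta_{n-1} = (1/tau_{n-1}) (1 - 2 M_n - i c_n)/(1 - i c_n), n >= 1;
    here [beta c M k] is beta_k. *)
Definition beta (c M : nat -> R) (k : nat) : R[i] :=
  (tau c k)^-1 * (Complex (1 - 2 * M k.+1) (- c k.+1)) / (Complex 1 (- c k.+1)).

(** gamma_0 = 1, gamma_n = (1 - M_n) gamma_{n-1}. *)
Fixpoint gamma (M : nat -> R) (n : nat) : R :=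
  match n with
  | 0 => 1
  | m.+1 => (1 - M m.+1) * gamma M m
  end.

(** Measures on the unit circle T are represented by measures on R
    concentrated on [0, 2 pi[ via the angle theta, zeta = e^{i theta}. *)
Definition expi (t : R) : R[i] := Complex (cos t) (sin t).

Definition circle_measure (nu : probability (measurableTypeR R) R) : Prop :=
  nu `[0, 2 * pi[%classic = 1%E.

(** nontrivial: not concentrated on finitely many points of T *)
Definition nontrivial (nu : probability (measurableTypeR R) R) : Prop :=
  forall s : seq R, nu (`[0, 2 * pi[%classic `\` [set x | x \in s]) <> 0%E.

(** complex integral over T of f(theta) d nu *)
Definition cintegral (nu : probability (measurableTypeR R) R) (f : R -> R[i]) : R[i] :=
  Complex (Rintegral nu `[0, 2 * pi[%classic (fun t => complex.Re (f t)))
          (Rintegral nu `[0, 2 * pi[%classic (fun t => complex.Im (f t))).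

(** Phi is the monic orthogonal polynomial of degree n for nu. *)
Definition monic_OP (nu : probability (measurableTypeR R) R) (n : nat)
    (Phi : {poly R[i]}) : Prop :=
  [/\ Phi \is monic, size Phi = n.+1 &
      forall k, (k < n)%N ->
        cintegral nu (fun t => Phi.[expi t] * (expi t ^+ k)^*) = 0].

(** alpha is the sequence of Verblunsky coefficients of nu:
    alpha_n = - conj(Phi_{n+1}(0)). *)
Definition verblunsky_coeffs (nu : probability (measurableTypeR R) R)
    (alpha : nat -> R[i]) : Prop :=
  forall n, exists2 Phi, monic_OP nu n.+1 Phi & alpha n = - (Phi.[0])^*.

End Defs.

(* Main.v *)
(** With [z = (x + i) / (x - i)], the polynomial [P_n(x)] becomes a polynomial
    [r_n(z)] of degree at most [n], and the choice of the Verblunsky coefficients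
    makes [(z - 1) r_n] a constant multiple of [z Phi_n - tau_n Phi_n^*], by the
    Szego recurrence.  The latter is orthogonal to [z, ..., z^n], so the moments
    of [r_n] against [1, z, ..., z^n] all have the same value [2^n gamma_n]; in
    other words [r_n] is a multiple of the Christoffel-Darboux kernel at [z = 1].
    The integrand of the theorem is, up to a constant,
    [(z + 1)^j (z - 1)^(n - j) r_n z^-n], which gives the formula as soon as [nu]
    has no atom at [z = 1].

    An atom of mass [t] at [1] would give [t |r_n(1)|^2 <= \int |r_n|^2], that is
    [t rho_n <= gamma_n], where [rho_n] and [gamma_n] solve the same recurrence
    [y_{n+1} = y_n - d_{n+1} y_{n-1}].  Then [gamma - (t/2) rho] is a positive
    solution whose ratios form a parameter sequence exceeding the maximal one. *)
Require Import Defs.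
From mathcomp Require Import all_boot all_order all_algebra.
From mathcomp Require Import complex.
From mathcomp Require Import all_classical all_reals all_analysis.
From mathcomp Require Import measurable_realfun ring lra.
Set Implicit Arguments. Unset Strict Implicit. Unset Printing Implicit Defensive.
Import Order.TTheory GRing.Theory Num.Theory.
Local Open Scope classical_set_scope.
Local Open Scope ring_scope.

(** * Complex integrals over the unit circle *)

Section CircleIntegral.
Variable R : realType.
Implicit Types (f g : R -> R[i]) (z w : R[i]).

(** This class is closed under sums, products and conjugation. Since [nu] is finite, it also gives
    integrability on every measurable set, so all integrability side conditions reduce to it. *)
Definition bounded_mfun f : Prop :=
  [/\ measurable_fun [set: R] (fun t : R => complex.Re (f t)),
      measurable_fun [set: R] (fun t : R => complex.Im (f t)) &
      exists B, forall t, `|complex.Re (f t)| <= B /\ `|complex.Im (f t)| <= B].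

Lemma bounded_mfun_cst z : bounded_mfun (fun=> z).
Proof.
split; [exact: measurable_cst | exact: measurable_cst |].
exists (Num.max `|complex.Re z| `|complex.Im z|) => t.
by rewrite !le_max !lexx orbT.
Qed.

Lemma bounded_mfunD f g :
  bounded_mfun f -> bounded_mfun g -> bounded_mfun (fun t => f t + g t).
Proof.
move=> [rf mf [B bf]] [rg mg [C bg]]; split.
- under eq_fun do rewrite raddfD /=.
  exact: measurable_funD.
- under eq_fun do rewrite raddfD /=.
  exact: measurable_funD.
- exists (B + C) => t; have [b1 b2] := bf t; have [c1 c2] := bg t.
  by rewrite !raddfD /=; split; apply: (le_trans (ler_normD _ _)); apply: lerD.
Qed.

Lemma Re_mulc z w : complex.Re (z * w) =
  complex.Re z * complex.Re w - complex.Im z * complex.Im w.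
Proof. by case: z w => a b [c e]. Qed.

Lemma Im_mulc z w : complex.Im (z * w) =
  complex.Re z * complex.Im w + complex.Im z * complex.Re w.
Proof. by case: z w => a b [c e]. Qed.

Lemma Re_conj z : complex.Re z^* = complex.Re z.
Proof. by case: z. Qed.

Lemma Im_conj z : complex.Im z^* = - complex.Im z.
Proof. by case: z. Qed.

Lemma bounded_mfunM f g :
  bounded_mfun f -> bounded_mfun g -> bounded_mfun (fun t => f t * g t).
Proof.
move=> [rf mf [B bf]] [rg mg [C bg]]; split.
- under eq_fun do rewrite Re_mulc.
  by apply: measurable_funB; apply: measurable_funM.
- under eq_fun do rewrite Im_mulc.
  by apply: measurable_funD; apply: measurable_funM.
- exists (B * C + B * C) => t; have [b1 b2] := bf t; have [c1 c2] := bg t.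
  rewrite Re_mulc Im_mulc; split.
    apply: (le_trans (ler_normB _ _)); rewrite !normrM.
    by apply: lerD; apply: ler_pM.
  apply: (le_trans (ler_normD _ _)); rewrite !normrM.
  by apply: lerD; apply: ler_pM.
Qed.

Lemma bounded_mfun_conj f : bounded_mfun f -> bounded_mfun (fun t => (f t)^*).
Proof.
move=> [rf mf [B bf]]; split.
- by under eq_fun do rewrite Re_conj.
- under eq_fun do rewrite Im_conj.
  exact: measurable_funN.
- by exists B => t; rewrite Re_conj Im_conj normrN.
Qed.

Lemma bounded_mfunX f n : bounded_mfun f -> bounded_mfun (fun t => f t ^+ n).
Proof.
move=> bf; elim: n => [|n IH]; first exact: bounded_mfun_cst.
by under eq_fun do rewrite exprS; apply: bounded_mfunM.
Qed.

Lemma bounded_mfun_expi : bounded_mfun (@expi R).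
Proof.
split.
- by apply: continuous_measurable_fun; exact: continuous_cos.
- by apply: continuous_measurable_fun; exact: continuous_sin.
- exists 1 => t /=; split; rewrite ler_norml.
    by rewrite cos_geN1 cos_le1.
  by rewrite sin_geN1 sin_le1.
Qed.

Lemma bounded_mfun_horner f (p : {poly R[i]}) :
  bounded_mfun f -> bounded_mfun (fun t => p.[f t]).
Proof.
move=> bf; elim/poly_ind: p => [|p c IH].
  by under eq_fun do rewrite horner0; apply: bounded_mfun_cst.
under eq_fun do rewrite hornerMXaddC.
by apply: bounded_mfunD; [apply: bounded_mfunM | apply: bounded_mfun_cst].
Qed.

Variable nu : probability (measurableTypeR R) R.
Local Notation I := (cintegral nu).
Local Notation T := (`[0, 2 * pi[%classic : set (measurableTypeR R)).

Lemma bounded_mfun_integrable f (D : set (measurableTypeR R)) : measurable D ->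
  bounded_mfun f ->
  nu.-integrable D (EFin \o (fun t => complex.Re (f t))) /\
  nu.-integrable D (EFin \o (fun t => complex.Im (f t))).
Proof.
move=> mD [rf mf [B bf]].
have nuD : (nu D < +oo)%E by rewrite (le_lt_trans (probability_le1 _ _)) ?ltry.
split; apply: measurable_bounded_integrable => //;
  try exact: (measurable_funS measurableT).
- exists B; split; first exact: num_real.
  by move=> x Bx t _ /=; have [/le_trans -> //] := bf t; exact: ltW.
- exists B; split; first exact: num_real.
  by move=> x Bx t _ /=; have [_ /le_trans -> //] := bf t; exact: ltW.
Qed.

Lemma measurable_circle : measurable T.
Proof. exact: measurable_itv. Qed.
Hint Resolve measurable_circle : core.

Lemma cintegralD f g : bounded_mfun f -> bounded_mfun g ->
  I (fun t => f t + g t) = I f + I g.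
Proof.
move=> bf bg.
have [rf mf] := bounded_mfun_integrable measurable_circle bf.
have [rg mg] := bounded_mfun_integrable measurable_circle bg.
rewrite /cintegral; apply/eqP; rewrite eq_complex /=; apply/andP; split; apply/eqP.
  rewrite -RintegralD //; apply: eq_Rintegral => t _; exact: raddfD.
rewrite -RintegralD //; apply: eq_Rintegral => t _; exact: raddfD.
Qed.

Lemma cintegralZ z f : bounded_mfun f -> I (fun t => z * f t) = z * I f.
Proof.
move=> bf.
have [rf mf] := bounded_mfun_integrable measurable_circle bf.
have iZ (r : R) (h : R -> R) : nu.-integrable T (EFin \o h) ->
    nu.-integrable T (EFin \o (fun t => r * h t)).
  by move=> ih; apply: (eq_integrable _ _ _ _ (integrableZl measurable_circle r ih)).
rewrite /cintegral; apply/eqP; rewrite eq_complex Re_mulc Im_mulc /=.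
apply/andP; split; apply/eqP.
  rewrite -!RintegralZl // -RintegralB //; try exact: iZ.
  by apply: eq_Rintegral => t _; exact: Re_mulc.
rewrite -!RintegralZl // -RintegralD //; try exact: iZ.
by apply: eq_Rintegral => t _; exact: Im_mulc.
Qed.

Lemma cintegral_conj f : bounded_mfun f -> I (fun t => (f t)^*) = (I f)^*.
Proof.
move=> bf.
have [rf mf] := bounded_mfun_integrable measurable_circle bf.
rewrite /cintegral; apply/eqP; rewrite eq_complex Re_conj Im_conj /=.
apply/andP; split; apply/eqP; first by apply: eq_Rintegral => t _; exact: Re_conj.
rewrite -mulN1r -RintegralZl //.
by apply: eq_Rintegral => t _; rewrite Im_conj mulN1r.
Qed.

Lemma cintegral_sum n (f : nat -> R -> R[i]) :
  (forall i, bounded_mfun (f i)) ->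
  I (fun t => \sum_(i < n) f i t) = \sum_(i < n) I (f i) /\
  bounded_mfun (fun t => \sum_(i < n) f i t).
Proof.
move=> bf; elim: n => [|n [IH1 IH2]].
  have -> : (fun t : R => \sum_(i < 0) f i t) = fun=> 0.
    by apply/funext => t; rewrite big_ord0.
  split; last exact: bounded_mfun_cst.
  have := cintegralZ 0 (bounded_mfun_cst 0).
  by rewrite !mul0r big_ord0.
have -> : (fun t : R => \sum_(i < n.+1) f i t) = fun t => \sum_(i < n) f i t + f n t.
  by apply/funext => t; rewrite big_ord_recr.
split; last exact: bounded_mfunD.
by rewrite cintegralD // IH1 big_ord_recr.
Qed.

Lemma cintegral1 : circle_measure nu -> I (fun=> 1) = 1.
Proof.
move=> cnu.
have cst (r : R) : Rintegral nu T (fun=> r) = r.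
  transitivity (r * fine (nu T)); first exact: Rintegral_cst.
  by move: cnu; rewrite /circle_measure => ->; rewrite mulr1.
by rewrite /cintegral /= !cst.
Qed.

(** Orthogonality on the circle concerns the interval closed at [0], while the real line corresponds
    to the open one. The angle [0], that is [z = 1], is the point sent to infinity. *)
Lemma Rintegral_circle_split f : bounded_mfun f ->
  Rintegral nu T (fun t => complex.Re (f t)) =
  complex.Re (f 0) * fine (nu [set 0]) +
  Rintegral nu `]0, 2 * pi[%classic (fun t => complex.Re (f t)).
Proof.
move=> bf.
have T0 : T = [set 0] `|` `]0, 2 * pi[%classic.
  by rewrite setU1itv // bnd_simp mulr_gt0 ?pi_gt0.
have [rf _] := bounded_mfun_integrable measurable_circle bf.
have m0 : measurable ([set 0] : set (measurableTypeR R)) by exact: measurable_set1.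
have m1 : measurable (`]0, 2 * pi[%classic : set (measurableTypeR R)).
  exact: measurable_itv.
rewrite T0 Rintegral_setU //; last 2 first.
- by rewrite -T0.
- by apply/disj_setPS => t /= [-> ]; rewrite in_itv /= ltxx.
congr (_ + _); rewrite -Rintegral_cst //.
by apply: eq_Rintegral => t; rewrite inE /= => ->.
Qed.

(** Equal values force [cos (u - t) = 1], hence [sin ((u - t) / 2) = 0], but for [t < u] the half
    difference lies strictly between [0] and [pi]. *)
Lemma expi_inj : {in T &, injective (@expi R)}.
Proof.
move=> t u; rewrite !inE /= !in_itv /= => Tt Tu.
wlog tu : t u Tt Tu / t <= u.
  move=> H; have [/H|/ltW /H] := leP t u; first by apply.
  by move=> H' E; apply/esym/H'.
move=> E; have [Ec Es] : cos t = cos u /\ sin t = sin u.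
  by move/eqP: E; rewrite eq_complex /= => /andP[/eqP -> /eqP ->].
have c1 : cos (u - t) = 1.
  by rewrite cosB Ec Es -!expr2 cos2Dsin2.
have s0 : sin ((u - t) / 2) = 0.
  have h : u - t = ((u - t) / 2) *+ 2 by rewrite -mulr_natr divfK.
  have : cos (((u - t) / 2) *+ 2) = 1 by rewrite -h.
  rewrite cos_mulr2n cos2sin2 => c2.
  by apply/eqP; rewrite -sqrf_eq0; apply/eqP; lra.
move: tu; rewrite le_eqVlt => /orP[/eqP //|tu].
have : 0 < sin ((u - t) / 2) by apply: sin_gt0_pi; lra.
by rewrite s0 ltxx.
Qed.

Lemma expi_norm (t : R) : expi t * (expi t)^* = 1.
Proof.
apply/eqP; rewrite eq_complex Re_mulc Im_mulc Re_conj Im_conj /=.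
rewrite mulrN opprK -!expr2 cos2Dsin2 eqxx /=.
by apply/eqP; ring.
Qed.

Lemma Re_mul_conj z : complex.Re (z * z^*) = complex.Re z ^+ 2 + complex.Im z ^+ 2.
Proof. by rewrite Re_mulc Re_conj Im_conj mulrN opprK !expr2. Qed.

Lemma Re_mul_conj_eq0 z : (complex.Re (z * z^*) == 0) = (z == 0).
Proof. by rewrite Re_mul_conj paddr_eq0 ?sqr_ge0 // !sqrf_eq0 eq_complex. Qed.

(** If the integral of [|p|^2] vanished, [p] would vanish almost everywhere, and [nu] would be
    carried by the finitely many angles of the roots of [p]. *)
Lemma cintegral_norm_neq0 (p : {poly R[i]}) : nontrivial nu -> p != 0 ->
  I (fun t => p.[expi t] * (p.[expi t])^*) != 0.
Proof.
move=> ntnu p0; apply/eqP => I0.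
pose h (t : R) := complex.Re (p.[expi t] * (p.[expi t])^*).
have bp : bounded_mfun (fun t => p.[expi t] * (p.[expi t])^*).
  have ? := bounded_mfun_horner p bounded_mfun_expi.
  by apply: bounded_mfunM => //; apply: bounded_mfun_conj.
have [ih _] := bounded_mfun_integrable measurable_circle bp.
have mh : measurable_fun T (EFin \o h) by exact: (measurable_int nu).
have h0 : (\int[nu]_(t in T) `|(EFin \o h) t|)%E = 0%E.
  have hE : (fun t => `|(EFin \o h) t|%E) = (EFin \o h).
    by apply/funext => t; rewrite /= ger0_norm // /h Re_mul_conj addr_ge0 ?sqr_ge0.
  rewrite hE -[LHS]fineK; last exact: integrable_fin_num.
  by congr EFin; exact: (congr1 (@complex.Re R) I0).
have /(ae_eq_integral_abs nu measurable_circle mh) := h0.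
move=> [N [mN N0 subN]].
have [rs prs] := closed_field_poly_normal p.
(* One angle per root. A root off the circle yields the default [0], which only adds a harmless
   point to the finite set. *)
pose s := [seq xget 0 [set t : R | T t /\ expi t = z] | z <- rs].
apply: (ntnu s).
apply: (@subset_measure0 _ _ _ nu _ N) => //.
  apply: measurableD => //; apply: countable_measurable.
    by move=> t; exact: measurable_set1.
  by apply: finite_set_countable; exact: finite_seq.
move=> t [Tt ts]; apply: subN => /= /(_ Tt) [] /eqP; rewrite /h Re_mul_conj_eq0.
rewrite prs hornerZ mulf_eq0 lead_coef_eq0 (negPf p0) /= horner_prod.
rewrite prodf_seq_eq0 => /hasP[z zrs]; rewrite hornerXsubC subr_eq0 => /eqP tz.
apply: ts => /=; apply/mapP; exists z => //.
have [|Tx xz] := @xgetPex _ 0 [set t : R | T t /\ expi t = z]; first by exists t.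
by apply: expi_inj; rewrite ?inE // tz.
Qed.

(** * Moments of a polynomial against powers of [z] *)

Definition moment k (p : {poly R[i]}) : R[i] :=
  I (fun t => p.[expi t] * (expi t ^+ k)^*).

Lemma bounded_mfun_moment k (p : {poly R[i]}) :
  bounded_mfun (fun t => p.[expi t] * (expi t ^+ k)^*).
Proof.
apply: bounded_mfunM; first by apply: bounded_mfun_horner; exact: bounded_mfun_expi.
by apply: bounded_mfun_conj; apply: bounded_mfunX; exact: bounded_mfun_expi.
Qed.

Lemma momentD k (p q : {poly R[i]}) : moment k (p + q) = moment k p + moment k q.
Proof.
rewrite /moment -cintegralD; try exact: bounded_mfun_moment.
by congr cintegral; apply/funext => t; rewrite hornerD mulrDl.
Qed.

Lemma momentZ k z (p : {poly R[i]}) : moment k (z *: p) = z * moment k p.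
Proof.
rewrite /moment -cintegralZ; last exact: bounded_mfun_moment.
by congr cintegral; apply/funext => t; rewrite hornerZ mulrA.
Qed.

Lemma momentB k (p q : {poly R[i]}) : moment k (p - q) = moment k p - moment k q.
Proof. by rewrite momentD -scaleN1r momentZ mulN1r. Qed.

Lemma momentXM k (p : {poly R[i]}) : moment k.+1 ('X * p) = moment k p.
Proof.
congr cintegral; apply/funext => t; rewrite ['X * p]mulrC hornerMX exprS rmorphM /=.
by rewrite -mulrA [expi t * _]mulrA expi_norm mul1r.
Qed.

Lemma expi_normX (t : R) k : expi t ^+ k * (expi t ^+ k)^* = 1.
Proof. by rewrite rmorphXn /= -exprMn expi_norm expr1n. Qed.

(** On the circle [z^n] times the conjugate of [z^k] is [z^(n - k)]. *)
Lemma moment_reversed n k (p q : {poly R[i]}) : (k <= n)%N ->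
  (forall t, q.[expi t] = expi t ^+ n * (p.[expi t])^*) ->
  moment k q = (moment (n - k) p)^*.
Proof.
move=> kn qp; rewrite /moment -cintegral_conj; last exact: bounded_mfun_moment.
congr cintegral; apply/funext => t.
rewrite qp -{1}(subnK kn) exprD rmorphM /= conjCK.
have := expi_normX t k; set a := _ ^+ k; set b := a^* => ab.
by rewrite mulrAC -[_ * a * b]mulrA ab mulr1 mulrC.
Qed.

(** With all moments equal, [r] acts up to the factor [lam] as a reproducing kernel at [z = 1]. The
    case [lam = 0] is plain orthogonality. *)
Lemma cintegral_mul_conj n (r q : {poly R[i]}) lam : (size q <= n)%N ->
  (forall k, (k < n)%N -> moment k r = lam) ->
  I (fun t => r.[expi t] * (q.[expi t])^*) = lam * (q.[1])^*.
Proof.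
move=> qn rlam.
have -> : (fun t => r.[expi t] * (q.[expi t])^*) =
    fun t => \sum_(k < n) (q`_k)^* * (r.[expi t] * (expi t ^+ k)^*).
  apply/funext => t; rewrite (horner_coef_wide _ qn) rmorph_sum mulr_sumr.
  by apply: eq_bigr => k _; rewrite rmorphM mulrCA.
have b k : bounded_mfun (fun t => (q`_k)^* * (r.[expi t] * (expi t ^+ k)^*)).
  by apply: bounded_mfunM; [exact: bounded_mfun_cst | exact: bounded_mfun_moment].
have [-> _] := cintegral_sum n b.
rewrite (horner_coef_wide _ qn) rmorph_sum mulr_sumr /=; apply: eq_bigr => k _.
rewrite cintegralZ; last exact: bounded_mfun_moment.
by rewrite -/(moment k r) rlam // expr1n mulr1 mulrC.
Qed.

(** The monomial [z^k] of [q] turns the conjugate of [z^n] into that of [z^(n - k)], so every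
    coefficient of [q] meets the same moment [lam]. *)
Lemma cintegral_mul_shift n (r q : {poly R[i]}) lam : (size q <= n.+1)%N ->
  (forall k, (k <= n)%N -> moment k r = lam) ->
  I (fun t => q.[expi t] * r.[expi t] * (expi t ^+ n)^*) = q.[1] * lam.
Proof.
move=> qn rlam.
have -> : (fun t => q.[expi t] * r.[expi t] * (expi t ^+ n)^*) =
    fun t => \sum_(k < n.+1) q`_k * (r.[expi t] * (expi t ^+ (n - k))^*).
  apply/funext => t; rewrite (horner_coef_wide _ qn) -mulrA mulr_suml.
  apply: eq_bigr => k _.
  have -> : expi t ^+ n = expi t ^+ (n - k) * expi t ^+ k.
    by rewrite -exprD subnK // -ltnS.
  rewrite rmorphM /=; have := expi_normX t k.
  set a := expi t ^+ k; set b := a^* => ab.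
  by rewrite -mulrA; congr (_ * _); rewrite mulrCA [_ * b]mulrC (mulrA a) ab mul1r.
have b k : bounded_mfun (fun t => q`_k * (r.[expi t] * (expi t ^+ (n - k))^*)).
  by apply: bounded_mfunM; [exact: bounded_mfun_cst | exact: bounded_mfun_moment].
have [-> _] := cintegral_sum n.+1 b.
rewrite (horner_coef_wide _ qn) mulr_suml; apply: eq_bigr => k _.
rewrite cintegralZ; last exact: bounded_mfun_moment.
by rewrite -/(moment (n - k) r) rlam ?leq_subr // expr1n mulr1.
Qed.

End CircleIntegral.

(** * Chain sequences and positive solutions of the attached linear recurrence *)

Section ChainSequence.
Variables (R : realType) (d M : nat -> R).

(** [rho] is the solution of [y_{n+1} = y_n - d_{n+1} y_{n-1}] attached to the
    minimal parameter sequence, [gamma M] the one attached to [M]. *)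
Fixpoint rho_pair n : R * R :=
  if n is m.+1 then let (p, q) := rho_pair m in (q, q - d m.+2 * p) else (1, 1).
Definition rho n := (rho_pair n).1.

Lemma rho_pairE n : rho_pair n = (rho n, rho n.+1).
Proof. by rewrite /rho /=; case: (rho_pair n). Qed.

Lemma rhoSS n : rho n.+2 = rho n.+1 - d n.+2 * rho n.
Proof. by rewrite {1}/rho /= rho_pairE. Qed.

Hypothesis paramM : is_param_seq d M.

Lemma gammaSS n : gamma M n.+2 = gamma M n.+1 - d n.+2 * gamma M n.
Proof.
by case: paramM => _ _ -> //=; ring.
Qed.

Lemma param_lt1 n : (1 <= n)%N -> M n < 1.
Proof.
case: paramM => /andP[_ M1] M2 _; case: n => [|[|n]] // _.
by have /andP[] := M2 n.+2 isT.
Qed.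

Lemma gamma_gt0 n : 0 < gamma M n.
Proof. by elim: n => //= n IH; rewrite mulr_gt0 // subr_gt0 param_lt1. Qed.

Lemma param_seq_unique (g h : nat -> R) : is_param_seq d g -> is_param_seq d h ->
  g 1%N = h 1%N -> forall n, (1 <= n)%N -> g n = h n.
Proof.
move=> [/andP[_ g1] g2 gd] [_ _ hd] gh1; elim=> // -[//|n] IH _.
have E : g n.+1 = h n.+1 by exact: IH.
have : 1 - g n.+1 != 0.
  rewrite subr_eq0 gt_eqF //; case: n {IH E} => [//|n].
  by have /andP[] := g2 n.+2 isT.
by move/mulfI; apply; rewrite -gd // hd // E.
Qed.

(** If [M 1] were [0], every parameter sequence would start at [0], and the first term determines
    all the others. *)
Lemma maximal_param1_gt0 : has_multiple_param_seqs d ->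
  is_maximal_param_seq d M -> 0 < M 1%N.
Proof.
move=> [g [h [dg dh [n n1 gh]]]] [_ maxM].
have [/andP[g1 _] _ _] := dg; have [/andP[h1 _] _ _] := dh.
have := maxM _ dg _ (leqnn 1); have := maxM _ dh _ (leqnn 1) => hM gM.
rewrite lt_neqAle (le_trans g1 gM) andbT; apply/eqP => M0.
apply: gh; apply: param_seq_unique => //.
by apply: le_anti; rewrite -M0 in hM gM; rewrite (le_trans gM h1) (le_trans hM g1).
Qed.

(** The positive solution [y = gamma M - s rho] would give the parameter sequence
    [1 - y_n / y_{n-1}], which exceeds [M] at [n = 1]. *)
Lemma maximal_not_dominated (s : R) : has_multiple_param_seqs d ->
  is_maximal_param_seq d M -> 0 < s -> ~ (forall n, s * rho n < gamma M n).
Proof.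
move=> multd maxM s0 dom; have M1 := maximal_param1_gt0 multd maxM.
pose y n := gamma M n - s * rho n.
have y0 n : 0 < y n by rewrite subr_gt0.
have ySS n : y n.+2 = y n.+1 - d n.+2 * y n.
  by rewrite /y gammaSS rhoSS; ring.
have d0 n : 0 < d n.+2.
  have [_ M2 ->] // := paramM.
  by rewrite mulr_gt0 ?subr_gt0 ?param_lt1 //; have /andP[] := M2 n.+2 isT.
pose g n := 1 - y n / y n.-1.
have g_lt1 n : g n < 1 by rewrite ltrBlDr ltrDl divr_gt0.
(* After clearing the denominator [y 0 = 1 - s], the inequality is [0 < s * M 1]. *)
have g1M : M 1%N < g 1%N.
  have := y0 0; have := y0 1%N; rewrite /g /y /rho /= !mulr1 => y1 y0'.
  rewrite ltrBrDr -ltrBrDl ltr_pdivrMr //.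
  by have := mulr_gt0 s0 M1; lra.
have gE n : g n.+2 = d n.+2 * y n / y n.+1.
  by rewrite /g /= ySS; field; rewrite gt_eqF.
have dg : is_param_seq d g.
  split; first by rewrite g_lt1 andbT ltW // (lt_trans M1).
    move=> [|[|n]] // _; rewrite g_lt1 andbT gE.
    by rewrite divr_gt0 ?mulr_gt0.
  move=> [|n] // _; rewrite gE /g /=.
  by field; rewrite !gt_eqF.
by case: maxM => _ /(_ _ dg _ (leqnn 1)); rewrite leNgt g1M.
Qed.

End ChainSequence.

(** * The Szego recurrence and its orthogonality relations *)

Section Szego.
Variables (R : realType) (nu : probability (measurableTypeR R) R).
Variable b : nat -> R[i].
Implicit Types (p q : {poly R[i]}).

(** The second component is [Phi_n^*], produced by the recurrence instead of by reversing
    coefficients; [szego_reversed] recovers the reversal on the circle. *)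
Fixpoint szego n : {poly R[i]} * {poly R[i]} :=
  if n is m.+1 then let (F, S) := szego m in
    ('X * F - (b m)^* *: S, S - b m *: ('X * F))
  else (1, 1).

Local Notation Phi n := (szego n).1.
Local Notation Phis n := (szego n).2.

Lemma szegoS n : szego n.+1 =
  ('X * Phi n - (b n)^* *: Phis n, Phis n - b n *: ('X * Phi n)).
Proof. by rewrite /=; case: (szego n). Qed.

Lemma szego_reversed n t :
  (Phis n).[expi t] = expi t ^+ n * ((Phi n).[expi t])^*.
Proof.
elim: n => [|n IH]; first by rewrite /= !hornerE rmorph1 ?mulr1.
rewrite szegoS /= !(hornerD, hornerN, hornerZ) ['X * _]mulrC hornerMX IH.
rewrite rmorphB !rmorphM /= !conjCK exprS.
have := expi_normX t n; have := expi_norm t.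
set z := expi t; set z' := z^*; set w := z ^+ n; set w' := w^* => zz ww.
set f := _.[z]; set f' := f^*.
have -> : z * w * (f' * z' - b n * (w' * f)) = z * z' * (w * f') - b n * z * (w * w') * f.
  by ring.
by rewrite zz ww; ring.
Qed.

Lemma szego_star0 n : (Phis n).[0] = 1.
Proof.
elim: n => [|n IH]; first by rewrite /= !hornerE.
by rewrite szegoS /= hornerD hornerN hornerZ hornerM hornerX mul0r mulr0 oppr0 addr0.
Qed.

Lemma szego_monic n :
  [/\ Phi n \is monic, size (Phi n) = n.+1 & (size (Phis n) <= n.+1)%N].
Proof.
elim: n => [|n [mF sF sS]]; first by rewrite /= monic1 size_poly1.
have sXF : size ('X * Phi n) = n.+2 by rewrite mulrC size_mulX ?monic_neq0 // sF.
have sbS : (size (- ((b n)^* *: Phis n))%R < size ('X * Phi n)%R)%N.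
  by rewrite sXF size_polyN ltnS (leq_trans (size_scale_leq _ _)).
rewrite szegoS /=; split.
- by rewrite monicE lead_coefDl // lead_coefM lead_coefX mul1r (monicP mF).
- by rewrite size_polyDl.
- rewrite (leq_trans (size_polyD _ _)) // geq_max size_polyN (leq_trans sS) //=.
  by rewrite (leq_trans (size_scale_leq _ _)) ?sXF.
Qed.

Hypothesis ntnu : nontrivial nu.

(** Such a [p] is orthogonal to itself. *)
Lemma moments_eq0 n p : (size p <= n)%N ->
  (forall k, (k < n)%N -> moment nu k p = 0) -> p = 0.
Proof.
move=> sp p0; apply/eqP/negPn/negP => /(cintegral_norm_neq0 ntnu)/eqP; apply.
by rewrite (cintegral_mul_conj sp p0) mul0r.
Qed.

Lemma szego_star_moment n k : (forall k, (k < n)%N -> moment nu k (Phi n) = 0) ->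
  (0 < k <= n)%N -> moment nu k (Phis n) = 0.
Proof.
move=> F0 /andP[k0 kn]; rewrite (moment_reversed nu kn (szego_reversed n)).
by rewrite F0 ?rmorph0 // -{2}[n]subn0 ltn_sub2l // (leq_trans k0).
Qed.

(** The hypothesis supplies some monic orthogonal [P] of degree [n + 1] with the same value at [0]
    as [Phi_{n+1}]. Their difference is [z E] with [E] of degree below [n], and the recurrence
    together with the induction hypothesis makes [E] orthogonal to [1, ..., z^(n-1)], so [E = 0]. *)
Lemma szego_moment : verblunsky_coeffs nu b ->
  forall n k, (k < n)%N -> moment nu k (Phi n) = 0.
Proof.
move=> vb; elim=> // n IH.
have [mF sF sS] := szego_monic n.+1.
have [P [mP sP oP] bP] := vb n.
suff -> : Phi n.+1 = P by move=> k kn; exact: oP.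
have P0 : P.[0] = - (b n)^* by rewrite bP rmorphN /= conjCK opprK.
pose D := P - Phi n.+1.
have D0 : D.[0] = 0.
  rewrite /D szegoS /= !(hornerD, hornerN, hornerZ, hornerM, hornerX) szego_star0 P0.
  by rewrite mul0r mulr1 sub0r subrr.
have [E DE] : exists E, D = E * 'X.
  by have /factor_theorem[E] : root D 0 by [apply/rootP]; rewrite subr0; exists E.
suff E0 : E = 0 by apply/esym/eqP; rewrite -subr_eq0 -/D DE E0 mul0r.
have DXE : D = 'X * E by rewrite DE mulrC.
apply: (@moments_eq0 n).
  have [->|En0] := eqVneq E 0; first by rewrite size_poly0.
  (* Both polynomials are monic of degree [n + 1], so their leading terms cancel. *)
  have : (size D < n.+2)%N.
    have lcP := monicP mP; have lcF := monicP mF.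
    rewrite ltnS; apply/leq_sizeP => i; rewrite leq_eqVlt => /orP[/eqP <-|ni].
      rewrite coefB; move: lcP lcF; rewrite /lead_coef sP sF /= => -> ->.
      by rewrite subrr.
    by rewrite coefB !nth_default ?subrr // ?sP ?sF.
  by rewrite DE size_mulX.
move=> k kn; rewrite -momentXM -DXE /D momentB [moment _ _ P]oP ?ltnS //.
rewrite szegoS /= momentB momentXM momentZ IH // szego_star_moment //.
by rewrite mulr0 !subr0.
Qed.

End Szego.

(** * The polynomials [rpoly] and their link with [Ppoly] and the Szego polynomials *)

Section ParaOrthogonal.
Variables (R : realType) (c d M : nat -> R).
Implicit Types z w : R[i].

Local Notation cplus n := (Complex 1 (c n)).
Local Notation cminus n := (Complex 1 (- c n)).

(** [r_n(z) = (-i)^n (z - 1)^n P_n(i (z + 1) / (z - 1))]. *)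
Fixpoint rpair n : {poly R[i]} * {poly R[i]} :=
  if n is m.+1 then let (p, q) := rpair m in
    (q, (cplus m.+2 *: 'X + (cminus m.+2)%:P) * q
        - (4 * d m.+2)%:C%C *: ('X * p))
  else (1, cplus 1%N *: 'X + (cminus 1%N)%:P).
Definition rpoly n := (rpair n).1.

Lemma rpairE n : rpair n = (rpoly n, rpoly n.+1).
Proof. by rewrite /rpoly /=; case: (rpair n). Qed.

Lemma rpolySS n : rpoly n.+2 =
  (cplus n.+2 *: 'X + (cminus n.+2)%:P) * rpoly n.+1
  - (4 * d n.+2)%:C%C *: ('X * rpoly n).
Proof. by rewrite {1}/rpoly /= rpairE. Qed.

Lemma PpairE n : Ppair c d n = (Ppoly c d n, Ppoly c d n.+1).
Proof. by rewrite /Ppoly /=; case: (Ppair c d n). Qed.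

Lemma PpolySS n : Ppoly c d n.+2 =
  ('X - (c n.+2)%:P) * Ppoly c d n.+1 - d n.+2 *: ('X ^+ 2 + 1) * Ppoly c d n.
Proof. by rewrite {1}/Ppoly /= PpairE. Qed.

Local Notation toC := (real_complex R).
Local Notation im := (Complex 0 1 : R[i]).

Lemma im_sqr : im * im = -1.
Proof. by rewrite -expr2 sqr_i. Qed.

Lemma ComplexE (a b : R) : Complex a b = toC a + im * toC b.
Proof. exact: (complexE (Complex a b)). Qed.

(** The Cayley relation is kept with its denominator cleared, so the induction is a polynomial
    identity without division. *)
Lemma rpoly_Ppoly z (x : R) n : toC x * (z - 1) = im * (z + 1) ->
  im ^+ n * (rpoly n).[z] = toC (Ppoly c d n).[x] * (z - 1) ^+ n.
Proof.
move=> xz.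
elim/ltn_ind: n => -[|[|n]] IH.
- by rewrite /rpoly /Ppoly /= !hornerE.
- rewrite /rpoly /Ppoly /= !hornerE /= rmorphB mulrBl xz.
  rewrite (ComplexE 1 (c _)) (ComplexE 1 (- _)) rmorphN rmorph1.
  transitivity (im * (z + 1) + (im * im) * toC (c 1%N) * (z - 1)); first by ring.
  by rewrite im_sqr; ring.
have H1 := IH n.+1 (ltnSn _); have H0 := IH n (ltnW (ltnSn _)).
rewrite rpolySS PpolySS !(hornerD, hornerN, hornerZ, hornerM, hornerX, hornerC, hornerXn).
rewrite !(rmorphD, rmorphN, rmorphM, rmorphXn, rmorph1, rmorph_nat).
set P := toC (Ppoly c d n).[x] in H0 *; set Q := toC (Ppoly c d n.+1).[x] in H1 *.
set X := toC x in xz *; set r0 := (rpoly n).[z] in H0 *; set r1 := (rpoly n.+1).[z] in H1 *.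
rewrite (ComplexE 1 (c _)) (ComplexE 1 (- _)) rmorphN rmorph1.
set C := toC (c n.+2); set D := toC (d n.+2).
have -> : ((X - C) * Q - D * (X ^+ 2 + 1) * P) * (z - 1) ^+ n.+2 =
    (X * (z - 1) - C * (z - 1)) * (Q * (z - 1) ^+ n.+1)
    - D * ((X * (z - 1)) ^+ 2 + (z - 1) ^+ 2) * (P * (z - 1) ^+ n).
  by rewrite !exprS; ring.
rewrite -H1 -H0 xz; apply/eqP; rewrite -subr_eq0; apply/eqP.
(* [ring] treats [im] as a free variable, so the difference of the two sides is exhibited as a
   multiple of [im * im + 1]. *)
transitivity ((im * im + 1) * (im ^+ n * (im * C * (z - 1) * r1 + D * (z - 1) ^+ 2 * r0))).
  by rewrite !exprS; ring.
by rewrite im_sqr addNr mul0r.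
Qed.

Lemma rpoly_size n : (size (rpoly n) <= n.+1)%N.
Proof.
elim/ltn_ind: n => -[|[|n]] IH; first by rewrite size_poly1.
  rewrite /rpoly /= (leq_trans (size_polyD _ _)) // geq_max.
  by rewrite (leq_trans (size_scale_leq _ _)) ?size_polyX // (leq_trans (size_polyC_leq1 _)).
rewrite rpolySS (leq_trans (size_polyD _ _)) // geq_max size_polyN; apply/andP; split.
  rewrite (leq_trans (size_polyMleq _ _)) //.
  have := IH n.+1 (ltnSn _) => s1; set u := (_ *: 'X + _).
  suff su : (size u <= 2)%N.
    by rewrite -subn1 leq_subLR add1n (leq_trans (leq_add su s1)).
  rewrite /u (leq_trans (size_polyD _ _)) // geq_max.
  by rewrite (leq_trans (size_scale_leq _ _)) ?size_polyX // (leq_trans (size_polyC_leq1 _)).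
rewrite (leq_trans (size_scale_leq _ _)) // mulrC (leq_trans (size_polyMleq _ _)) //.
have := IH n (ltnW (ltnSn _)) => s0.
by rewrite size_polyX addn2 /= ltnS (leq_trans s0).
Qed.

(** At [z = 1] the linear factor is [(1 + i c) + (1 - i c) = 2], and dividing by [2 ^+ n] leaves the
    recurrence of [rho]. *)
Lemma rpoly1 n : (rpoly n).[1] = toC (2 ^+ n * rho d n).
Proof.
elim/ltn_ind: n => -[|[|n]] IH.
- by rewrite /rpoly /rho /= !hornerE rmorph1.
- rewrite /rpoly /rho /= !hornerE /= (ComplexE 1 (c _)) (ComplexE 1 (- _)) rmorphN.
  by rewrite rmorph1 rmorph_nat; ring.
rewrite rpolySS rhoSS !(hornerD, hornerN, hornerZ, hornerM, hornerX, hornerC).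
rewrite (IH n.+1) // (IH n) // (ComplexE 1 (c _)) (ComplexE 1 (- _)).
rewrite !exprS !(rmorphD, rmorphN, rmorphM, rmorphXn, rmorph1, rmorph_nat).
by ring.
Qed.

Lemma conj_Complex (a b : R) : (Complex a b)^* = Complex a (- b).
Proof. by []. Qed.

Lemma tau_norm n : tau c n * (tau c n)^* = 1.
Proof.
elim: n => [|n IH]; first by rewrite /= rmorph1 mulr1.
rewrite /= !rmorphM /= fmorphV /=.
rewrite !conj_Complex opprK -[RHS]IH; field.
by rewrite !eq_complex /= !oner_eq0.
Qed.

Lemma tau_neq0 n : tau c n != 0.
Proof.
have := tau_norm n; case: eqP => // ->.
by rewrite mul0r => /esym/eqP; rewrite oner_eq0.
Qed.

Lemma tau_beta n :
  tau c n * beta c M n * cminus n.+1 = Complex (1 - 2 * M n.+1) (- c n.+1).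
Proof.
rewrite /beta; field; rewrite tau_neq0 eq_complex /= oner_eq0.
by [].
Qed.

Lemma conj_beta n :
  (beta c M n)^* * cplus n.+1 = tau c n * Complex (1 - 2 * M n.+1) (c n.+1).
Proof.
move: (beta c M n) (tau_beta n) => b /(congr1 Num.conj); rewrite !rmorphM /=.
rewrite !conj_Complex !opprK => <-.
by rewrite -!mulrA [RHS]mulrA tau_norm mul1r.
Qed.

(** This is the coefficient of [z^n] in [rpoly n]. *)
Fixpoint kappa n : R[i] := if n is m.+1 then kappa m * cplus m.+1 else 1.


Hypothesis paramM : is_param_seq d M.
Local Notation Phi n := (szego (beta c M) n).1.
Local Notation Phis n := (szego (beta c M) n).2.

(** The two identities are proved together. The first makes the moments of [rpoly n] equal; the
    second relates those of [rpoly n.+1] and [rpoly n]. *)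
Lemma kappa_szego n :
  (kappa n)%:P * ('X * Phi n - (tau c n)%:P * Phis n) = ('X - 1) * rpoly n /\
  (kappa n.+1)%:P * Phi n.+1 = rpoly n.+1 - (toC (2 * (1 - M n.+1)))%:P * rpoly n.
Proof.
(* All constants are rewritten through [I], [C] and [m], which reduces the later verifications to
   [ring]. *)
have split_poly a b' : (Complex a b')%:P = (toC a)%:P + im%:P * (toC b')%:P :> {poly R[i]}.
  by rewrite ComplexE polyCD polyCM.
pose C n := (toC (c n))%:P : {poly R[i]}; pose m n := (toC (M n))%:P : {poly R[i]}.
pose I : {poly R[i]} := im%:P.
have cpE k : (cplus k)%:P = 1 + I * C k by rewrite split_poly rmorph1.
have cmE k : (cminus k)%:P = 1 - I * C k by rewrite split_poly rmorph1 rmorphN polyCN mulrN.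
have kE k : (toC (2 * (1 - M k)))%:P = 2 * (1 - m k).
  by rewrite /m !(rmorphM, rmorphB, rmorph1, rmorph_nat).
have m2E k b' : (Complex (1 - 2 * M k) b')%:P = 1 - 2 * m k + I * (toC b')%:P.
  by rewrite split_poly /m !(rmorphM, rmorphB, rmorph1, rmorph_nat).
have tb k : (tau c k)%:P * (beta c M k)%:P * (1 - I * C k.+1) = 1 - 2 * m k.+1 - I * C k.+1.
  by rewrite -cmE -(polyCM (tau c k)) -(polyCM (tau c k * _)) tau_beta m2E
     rmorphN polyCN mulrN.
have tb' k : ((beta c M k)^*)%:P * (1 + I * C k.+1) =
    (tau c k)%:P * (1 - 2 * m k.+1 + I * C k.+1).
  by rewrite -cpE -(polyCM (_^*)) conj_beta polyCM m2E.
have kS k : (kappa k.+1)%:P = (kappa k)%:P * (1 + I * C k.+1) by rewrite /= polyCM cpE.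
(* The first identity at [k] eliminates [Phis k] from the Szego recurrence. *)
have step k : (kappa k)%:P * ('X * Phi k - (tau c k)%:P * Phis k) = ('X - 1) * rpoly k ->
    (kappa k.+1)%:P * Phi k.+1 = 2 * m k.+1 * ('X * ((kappa k)%:P * Phi k))
      + (1 - 2 * m k.+1 + I * C k.+1) * (('X - 1) * rpoly k).
  move=> <-; rewrite szegoS kS [fst _]/= -mul_polyC.
  transitivity ((kappa k)%:P * ((1 + I * C k.+1) * 'X * Phi k
     - ((beta c M k)^*)%:P * (1 + I * C k.+1) * Phis k)); first by ring.
  by rewrite tb'; ring.
elim: n => [|n [IH1 IH2]].
  have h : (kappa 0)%:P * ('X * Phi 0%N - (tau c 0)%:P * Phis 0%N) = ('X - 1) * rpoly 0.
    by rewrite /rpoly /= !mulr1 mul1r.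
  split=> //; rewrite (step _ h) kE /rpoly /= -mul_polyC cpE cmE.
  by ring.
have H1 : (kappa n.+1)%:P * ('X * Phi n.+1 - (tau c n.+1)%:P * Phis n.+1) =
    ('X - 1) * rpoly n.+1.
  have tS : (kappa n.+1)%:P * (tau c n.+1)%:P = (kappa n)%:P * (tau c n)%:P * (1 - I * C n.+1).
    rewrite -cmE -!(polyCM (kappa _)) -(polyCM (_ * _)); congr (_%:P); rewrite /=; field.
    by rewrite eq_complex /= oner_eq0.
  have SE : (kappa n.+1)%:P * (tau c n.+1)%:P * Phis n.+1 =
      2 * m n.+1 * ('X * ((kappa n)%:P * Phi n)) - (1 - I * C n.+1) * (('X - 1) * rpoly n).
    rewrite tS szegoS [snd _]/= -mul_polyC -IH1.
    transitivity ((kappa n)%:P * ((tau c n)%:P * (1 - I * C n.+1) * Phis n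
       - (tau c n)%:P * (beta c M n)%:P * (1 - I * C n.+1) * 'X * Phi n)); first by ring.
    by rewrite tb; ring.
  transitivity ('X * ((kappa n.+1)%:P * Phi n.+1) -
    (kappa n.+1)%:P * (tau c n.+1)%:P * Phis n.+1).
    by ring.
  rewrite SE.
  (* Two expressions for the same multiple of [Phi n.+1] are compared and solved for
     [rpoly n.+1]. *)
  have := step _ IH1; rewrite IH2 kE => /eqP; rewrite eq_sym -subr_eq => /eqP <-.
  by ring.
split=> //; rewrite (step _ H1) IH2 !kE rpolySS -!mul_polyC cpE cmE.
have -> : (toC (4 * d n.+2))%:P = 4 * ((1 - m n.+1) * m n.+2).
  have [_ _ ->] // := paramM.
  by rewrite /m !(rmorphM, rmorphB, rmorph1, rmorph_nat).
by ring.
Qed.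

(** * Moments of [rpoly] under [nu] and the mass at [z = 1] *)

Variable nu : probability (measurableTypeR R) R.
Hypotheses (cnu : circle_measure nu) (ntnu : nontrivial nu).
Hypothesis vnu : verblunsky_coeffs nu (beta c M).

(** Consecutive moments differ by a moment of [(z - 1) r_n] of order between [1] and [n], which is
    zero. For the common value, [Phi_{n+1}] is orthogonal to [1], so the second identity of
    [kappa_szego] gives the factor [2 (1 - M_{n+1})]. *)
Lemma rpoly_moment n k : (k <= n)%N ->
  moment nu k (rpoly n) = toC (2 ^+ n * gamma M n).
Proof.
have const m j : (j <= m)%N -> moment nu j (rpoly m) = moment nu 0 (rpoly m).
  elim: j => // j IH jm; rewrite -IH ?(ltnW jm) //.
  apply/esym/eqP; rewrite -subr_eq0 -(momentXM _ j) -momentB.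
  have -> : 'X * rpoly m - rpoly m = ('X - 1) * rpoly m by rewrite mulrBl mul1r.
  have [<- _] := kappa_szego m.
  rewrite !mul_polyC momentZ momentB momentXM momentZ.
  rewrite (szego_moment ntnu vnu) //.
  rewrite (szego_star_moment (fun i => @szego_moment _ _ _ ntnu vnu m i)) //.
  by rewrite mulr0 subrr mulr0.
move=> kn; rewrite const {k kn} //; elim: n => [|n IH].
  rewrite /rpoly /= mulr1 rmorph1 -(cintegral1 cnu) /moment.
  by congr (cintegral _ _); apply/funext => t; rewrite hornerC rmorph1 mulr1.
have [_ /eqP] := kappa_szego n; rewrite eq_sym subr_eq => /eqP ->.
rewrite !mul_polyC momentD !momentZ IH (szego_moment ntnu vnu) // mulr0 add0r.
by rewrite -rmorphM /= exprS; congr (_%:C)%C; ring.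
Qed.

Lemma expi0 : expi (0 : R) = 1.
Proof. by rewrite /expi cos0 sin0. Qed.

(** The kernel property gives [4^n gamma_n rho_n] for the integral of [|r_n|^2], and the atom alone
    contributes its mass times [4^n rho_n^2]. *)
Lemma atom_rho n : fine (nu [set 0]) * rho d n ^+ 2 <= gamma M n * rho d n.
Proof.
have bm : bounded_mfun (fun t : R => (rpoly n).[expi t] * ((rpoly n).[expi t])^*).
  have ? := bounded_mfun_horner (rpoly n) (@bounded_mfun_expi R).
  by apply: bounded_mfunM => //; apply: bounded_mfun_conj.
have := cintegral_mul_conj (rpoly_size n) (fun k kn => rpoly_moment (kn : (k <= n)%N)).
move/(congr1 (@complex.Re R)); rewrite {1}/cintegral [LHS]/= Rintegral_circle_split //.
rewrite expi0 rpoly1 conj_Complex oppr0 -!rmorphM /= => E.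
have : 0 <= Rintegral nu `]0, 2 * pi[%classic
    (fun t => complex.Re ((rpoly n).[expi t] * ((rpoly n).[expi t])^*)).
  by apply: Rintegral_ge0 => t _; rewrite Re_mul_conj addr_ge0 ?sqr_ge0.
set J := Rintegral _ _ _ in E * => J0.
have k0 : 0 < (2 ^+ n * 2 ^+ n : R) by rewrite mulr_gt0 ?exprn_gt0.
rewrite -(ler_pM2l k0).
set t := fine _ in E *.
have -> : 2 ^+ n * 2 ^+ n * (gamma M n * rho d n) =
    2 ^+ n * gamma M n * (2 ^+ n * rho d n) by ring.
rewrite -E (_ : _ * (t * _) = 2 ^+ n * rho d n * (2 ^+ n * rho d n) * t) ?lerDl //.
by ring.
Qed.

Lemma no_atom : has_multiple_param_seqs d -> is_maximal_param_seq d M ->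
  fine (nu [set 0]) = 0.
Proof.
move=> multd maxM; apply/eqP/negPn/negP => t0.
have tgt0 : 0 < fine (nu [set 0]) by rewrite lt_neqAle eq_sym t0 fine_ge0.
(* Halving the mass turns the weak bound of [atom_rho] into a strict one. Where [rho d n] is
   nonpositive the bound is immediate, so no positivity of [rho] has to be shown. *)
apply: (maximal_not_dominated paramM (s := fine (nu [set 0]) / 2)) => //.
  by rewrite divr_gt0.
move=> n; have g0 := gamma_gt0 paramM n; have [r0|r0] := lerP (rho d n) 0.
  by rewrite (le_lt_trans _ g0) // mulr_ge0_le0 // ltW // divr_gt0.
have := atom_rho n; rewrite expr2 mulrA ler_pM2r // => H.
by nra.
Qed.

End ParaOrthogonal.

(** * The Cayley transform between the real line and the circle *)

Section ChangeOfVariable.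
Variables (R : realType) (c d : nat -> R).
Local Notation toC := (real_complex R).
Local Notation im := (Complex 0 1 : R[i]).

(** Half-angle formulas identify [i (z + 1) / (z - 1)] with the cotangent of half the angle. *)
Lemma cot_half_expi (t : R) : 0 < t < 2 * pi ->
  toC (cos (t / 2) / sin (t / 2)) * (expi t - 1) = im * (expi t + 1).
Proof.
move=> t0; have s0 : sin (t / 2) != 0.
  by rewrite gt_eqF // sin_gt0_pi //; lra.
have h : t = (t / 2) *+ 2 by rewrite -mulr_natr divfK.
have ct : cos t = cos (t / 2) ^+ 2 *+ 2 - 1 by rewrite {1}h cos_mulr2n.
have st : sin t = cos (t / 2) * sin (t / 2) *+ 2 by rewrite {1}h sin_mulr2n.
have cs := cos2Dsin2 (t / 2).
apply/eqP; rewrite eq_complex !Re_mulc !Im_mulc !raddfD !raddfN /= ct st.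
set k := cos _ in cs *; set s := sin _ in cs s0 *.
have ks : k ^+ 2 = 1 - s ^+ 2 by rewrite -cs addrK.
apply/andP; split; apply/eqP; last by field.
rewrite ks; field => //.
Qed.

(** Up to the factor [i^j], this is [x^j (z - 1)^n]. It vanishes at [z = 1] exactly when [j < n],
    which is the source of the Kronecker delta. *)
Definition weight_poly n j : {poly R[i]} := ('X + 1) ^+ j * ('X - 1) ^+ (n - j).

Lemma weight_poly_size n j : (j <= n)%N -> (size (weight_poly n j) <= n.+1)%N.
Proof.
move=> jn.
have s1 : (size (('X + 1 : {poly R[i]}) ^+ j) <= j.+1)%N.
  by rewrite (leq_trans (size_poly_exp_leq _ _)) // -polyC1 size_XaddC mul1n.
have s2 : (size (('X - 1 : {poly R[i]}) ^+ (n - j)) <= (n - j).+1)%N.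
  by rewrite (leq_trans (size_poly_exp_leq _ _)) // -polyC1 size_XsubC mul1n.
rewrite (leq_trans (size_polyMleq _ _)) // -subn1 leq_subLR.
by rewrite (leq_trans (leq_add s1 s2)) // addSn addnS subnKC.
Qed.

Lemma cayley_integrand n j z (x : R) : (j <= n)%N -> z * z^* = 1 ->
  toC x * (z - 1) = im * (z + 1) ->
  toC (x ^+ j * (Ppoly c d n).[x] / (x ^+ 2 + 1) ^+ n) =
  im ^+ (n + j) / (- 4) ^+ n *
    ((weight_poly n j).[z] * (rpoly c d n).[z] * (z ^+ n)^*).
Proof.
move=> jn zz xz.
have z0 : z != 0 by apply: contra_eq_neq zz => ->; rewrite mul0r eq_sym oner_neq0.
have w0 : z - 1 != 0.
  rewrite subr_eq0; apply: contra_eq_neq xz => ->; rewrite subrr mulr0 eq_sym.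
  by rewrite mulf_neq0 ?pnatr_eq0 // eq_complex /= oner_eq0 andbF.
have rP := rpoly_Ppoly c d n xz.
have -> : toC (x ^+ j * (Ppoly c d n).[x] / (x ^+ 2 + 1) ^+ n) =
    toC x ^+ j * toC (Ppoly c d n).[x] / (toC x ^+ 2 + 1) ^+ n.
  by rewrite !rmorphM fmorphV !rmorphXn rmorphD rmorphXn rmorph1.
set X := toC x in xz rP *; set P := toC _.[x] in rP *; set w := z - 1 in xz w0 rP *.
(* Here [(z - 1)^2 - (z + 1)^2 = - 4 z]; this produces both the constant [(- 4) ^+ n] and the power
   [z^-n]. *)
have base : (X ^+ 2 + 1) * w ^+ 2 = (- 4) * z.
  rewrite mulrDl mul1r -exprMn xz exprMn expr2 im_sqr /w; by ring.
have X0 : X ^+ 2 + 1 != 0.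
  by apply: contra_eq_neq base => ->; rewrite mul0r eq_sym mulf_neq0 // oppr_eq0 pnatr_eq0.
have -> : (z ^+ n)^* = z ^- n.
  by rewrite rmorphXn /= -exprVn; congr (_ ^+ n); apply: (mulfI z0); rewrite zz mulfV.
rewrite /weight_poly hornerM !horner_exp !(hornerD, hornerN, hornerX) !hornerC -/w.
have base' : (X ^+ 2 + 1) ^+ n * (w ^+ n * w ^+ n) = (- 4) ^+ n * z ^+ n.
  by rewrite -exprMn -expr2 -!exprMn -base exprMn.
have xz' : X ^+ j * w ^+ j = im ^+ j * (z + 1) ^+ j by rewrite -!exprMn xz.
have wn : w ^+ n = w ^+ j * w ^+ (n - j) by rewrite -exprD subnKC.
have f0 : (- 4) ^+ n != 0 :> R[i] by rewrite expf_neq0 // oppr_eq0 pnatr_eq0.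
have -> : X ^+ j * P / (X ^+ 2 + 1) ^+ n =
    (X ^+ j * w ^+ j) * (P * w ^+ n) * w ^+ (n - j) / ((- 4) ^+ n * z ^+ n).
  rewrite -base' wn; field.
  by rewrite !expf_neq0.
rewrite xz' -rP exprD.
by field; rewrite f0 expf_neq0.
Qed.

End ChangeOfVariable.

(** * Evaluation of the integrals on the real line *)

Theorem theorem1p2 (R : realType) (c d M : nat -> R)
    (nu : probability (measurableTypeR R) R) :
  positive_chain_seq d ->
  has_multiple_param_seqs d ->
  is_maximal_param_seq d M ->
  circle_measure nu ->
  nontrivial nu ->
  verblunsky_coeffs nu (beta c M) ->
  forall n j : nat, (j <= n)%N ->
    Rintegral nu `]0, 2 * pi[%classic
      (fun t => let x := cos (t / 2) / sin (t / 2) in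
                x ^+ j * (Ppoly c d n).[x] / (x ^+ 2 + 1) ^+ n)
    = gamma M n * (n == j)%:R.
Proof.
move=> _ multd maxM cnu ntnu vnu n j jn.
have paramM := maxM.1.
pose Z : R[i] := Complex 0 1 ^+ (n + j) / (- 4) ^+ n.
pose G (t : R) := (weight_poly R n j).[expi t] * (rpoly c d n).[expi t] * (expi t ^+ n)^*.
have bG : bounded_mfun G.
  have bp p := bounded_mfun_horner p (@bounded_mfun_expi R).
  apply: bounded_mfunM; first exact: bounded_mfunM.
  by apply: bounded_mfun_conj; apply: bounded_mfunX; exact: bounded_mfun_expi.
have bZG : bounded_mfun (fun t => Z * G t).
  by apply: bounded_mfunM => //; exact: bounded_mfun_cst.
transitivity (Rintegral nu `]0, 2 * pi[%classic (fun t => complex.Re (Z * G t))).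
  apply: eq_Rintegral => t; rewrite inE /= in_itv /= => t0.
  by rewrite -(cayley_integrand c d jn (expi_norm t) (cot_half_expi t0)).
(* Without an atom at [z = 1], the open interval can be replaced by the whole circle. *)
have -> : Rintegral nu `]0, 2 * pi[%classic (fun t => complex.Re (Z * G t)) =
    complex.Re (cintegral nu (fun t => Z * G t)).
  rewrite /cintegral [RHS]/= Rintegral_circle_split //.
  by rewrite (no_atom paramM cnu ntnu vnu multd maxM) mulr0 add0r.
rewrite cintegralZ // (cintegral_mul_shift (weight_poly_size R jn)
  (fun k => @rpoly_moment _ c _ _ paramM _ cnu ntnu vnu n k)).
rewrite /weight_poly hornerM !horner_exp !(hornerD, hornerN, hornerX) !hornerC subrr /Z.
(* For [j < n] the factor [(z - 1)^(n - j)] vanishes at [1]; for [j = n] the constants [i^(2n)],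
   [(- 4)^(-n)], [2^n] and [2^n] multiply to [1]. *)
have [<-|nj] := eqVneq n j; last first.
  by rewrite expr0n subn_eq0 leqNgt ltn_neqAle jn eq_sym nj /= !(mulr0, mul0r).
rewrite subnn expr0 mulr1 addnn -mul2n exprM sqr_i.
have -> : (-1) ^+ n / (- 4) ^+ n * ((1 + 1) ^+ n * real_complex R (2 ^+ n * gamma M n)) =
    real_complex R (gamma M n).
  rewrite rmorphM rmorphXn rmorph_nat mulrA mulrA.
  have -> : (-1) ^+ n / (- 4) ^+ n * (1 + 1) ^+ n * 2 ^+ n = 1 :> R[i].
    rewrite -expr_div_n -!exprMn (_ : _ * _ = 1) ?expr1n //.
    by field.
  by rewrite mul1r.
by rewrite mulr1.
Qed.
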